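(* For every time step size $\tau>0$ and every $n\ge0$, the iterates $(u^n,s^n)$ of the GSAV-EI2 scheme satisfy $$\mathcal{E}_h(u^{n+1},s^{n+1})\le\mathcal{E}_h(u^n,s^n).$$
   Context: Spatial setting. Let $L>0$, $\Omega=(0,L)\times(0,L)$, $|\Omega|=L^2$, $M$ a positive integer, $h=L/M$. Let $\mathcal{M}_h$ be the finite-dimensional space of real grid functions $v=(v_{ij})_{i,j\in\mathbb{Z}}$ that are $M$-periodic in each index. For $v,w\in\mathcal{M}_h$ set $\langle v,w\rangle=h^2\sum_{i,j=1}^M v_{ij}w_{ij}$, $\|v\|=\sqrt{\langle v,v\rangle}$, $\|v\|_\infty=\max_{1\le i,j\le M}|v_{ij}|$; for pairs of grid functions $\mathbf v=(v^1,v^2)$, $\mathbf w=(w^1,w^2)$ set $\langle \mathbf v,\mathbf w\rangle=\langle v^1,w^1\rangle+\langle v^2,w^2\rangle$ and $\|\mathbf v\|=\sqrt{\langle \mathbf v,\mathbf v\rangle}$. The discrete Laplacian is $\Delta_h v_{ij}=h^{-2}(v_{i+1,j}+v_{i-1,j}+v_{i,j+1}+v_{i,j-1}-4v_{ij})$ and the discrete gradient is $\nabla_h v_{ij}=\big(\frac{v_{i+1,j}-v_{ij}}{h},\frac{v_{i,j+1}-v_{ij}}{h}\big)^T$. Scalar functions act on grid functions pointwise; functions of self-adjoint linear operators on $\mathcal{M}_h$ are understood as matrix functions; $I$ is the identity. Standing assumptions. $\varepsilon>0$; $f:\mathbb{R}\to\mathbb{R}$ is continuously differentiable and there is a constant $\beta>0$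 (fixed) with $f(\beta)\le 0\le f(-\beta)$; $F$ is a function with $F'=-f$; $u_{\rm init}\in\mathcal{M}_h$ is the (grid-projected) initial value; $\kappa>0$ is a stabilizing constant; $\sigma:\mathbb{R}\to\mathbb{R}$ is continuously differentiable with $\sigma>0$ and $\sigma'\ge0$ on $\mathbb{R}$. Energies. $E_{1h}(v)=\langle F(v),1\rangle$, $E_h(v)=\frac{\varepsilon^2}{2}\|\nabla_h v\|^2+E_{1h}(v)$, and the modified energy is $\mathcal{E}_h(v,r)=\frac{\varepsilon^2}{2}\|\nabla_h v\|^2+r$, for $v\in\mathcal{M}_h$, $r\in\mathbb{R}$. Set $g(v,r)=\sigma(r)/\sigma(E_{1h}(v))$. GSAV-EI2 scheme with step $\tau>0$. $u^0=u_{\rm init}$, $s^0=E_{1h}(u^0)$; let $\phi_1(a)=a^{-1}(e^a-1)$ for $a\ne0$. For $n\ge0$, given $(u^n,s^n)$: (Prediction) with $L_\kappa^n=\kappa g(u^n,s^n)I-\varepsilon^2\Delta_h$ and $N_\kappa^n(v,r)=g(v,r)f(v)+\kappa g(u^n,s^n)v$, $$\widetilde u^{n+1}=e^{-\tau L_\kappa^n}u^n+\tau\phi_1(-\tau L_\kappa^n)N_\kappa^n(u^n,s^n),\qquad \widetilde s^{n+1}=s^n-g(u^n,s^n)\langle f(u^n),\widetilde u^{n+1}-u^n\rangle,$$ and $\widetilde u^{n+\frac12}=\frac12(u^n+\widetilde u^{n+1})$, $\widetilde s^{n+\frac12}=\frac12(s^n+\widetilde s^{n+1})$. (Correction) with $\widetilde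 g=g(\widetilde u^{n+\frac12},\widetilde s^{n+\frac12})$, $L_\kappa^{n+\frac12}=\kappa\widetilde g I-\varepsilon^2\Delta_h$ and $N_\kappa^{n+\frac12}(v,r)=g(v,r)f(v)+\kappa\widetilde g v$, $$u^{n+1}=e^{-\tau L_\kappa^{n+\frac12}}u^n+\tau\phi_1(-\tau L_\kappa^{n+\frac12})N_\kappa^{n+\frac12}(\widetilde u^{n+\frac12},\widetilde s^{n+\frac12}),$$ $$s^{n+1}=s^n-\widetilde g\,\langle f(\widetilde u^{n+\frac12}),u^{n+1}-u^n\rangle+\frac{\kappa}{2}\widetilde g\,\langle u^{n+1}-\widetilde u^{n+1},u^{n+1}-u^n\rangle.$$ *)

(* Defs.v *)
From HB Require Import structures.
From mathcomp Require Import all_boot all_order all_algebra ring.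
From mathcomp Require Import all_classical all_reals all_analysis.

Set Implicit Arguments.
Unset Strict Implicit.
Unset Printing Implicit Defensive.

Import Order.TTheory GRing.Theory Num.Theory.
Import numFieldNormedType.Exports.

Local Open Scope ring_scope.

Definition C1 (R : realType) (f : R -> R) : Prop :=
  (forall x, derivable f x 1) /\ continuous (derive1 f).

(* A grid function that is M-periodic in each index is represented by its
   values on one period, a matrix in 'M[R]_M; the index shifts i + 1 and i - 1
   are then the cyclic ones, ordS i and ord_pred i. *)
Section Grid.
Context {R : realType} {M : nat}.
Implicit Types (h : R) (v w : 'M[R]_M) (A : 'End('M[R]_M)).

Definition ip h v w : R := h ^+ 2 * \sum_(i < M) \sum_(j < M) v i j * w i j.

Definition ip2 h (v w : 'M[R]_M * 'M[R]_M) : R :=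
  ip h v.1 w.1 + ip h v.2 w.2.

Definition norm2 h (v : 'M[R]_M * 'M[R]_M) : R := Num.sqrt (ip2 h v v).

Definition grad h v : 'M[R]_M * 'M[R]_M :=
  (\matrix_(i, j) ((v (ordS i) j - v i j) / h),
   \matrix_(i, j) ((v i (ordS j) - v i j) / h)).

Definition lap_fun h v : 'M[R]_M :=
  \matrix_(i, j) (h ^- 2 * (v (ordS i) j + v (ord_pred i) j
                            + v i (ordS j) + v i (ord_pred j) - 4 * v i j)).

Fact lap_fun_is_linear h : linear (lap_fun h).
Proof. by move=> a v w; apply/matrixP => i j; rewrite !mxE; ring. Qed.

HB.instance Definition _ h :=
  GRing.isLinear.Build R 'M[R]_M 'M[R]_M *:%R (lap_fun h)
    (lap_fun_is_linear h).

Definition lap h : 'End('M[R]_M) := linfun (lap_fun h).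

Lemma lapE h v : lap h v = lap_fun h v.
Proof. exact: lfunE. Qed.

(* A family of M ^ 2 eigenpairs (e k, lambda k) of A whose eigenvectors are
   orthonormal for ip h, hence a basis of the M ^ 2-dimensional space of grid
   functions; one exists exactly when A is self-adjoint for ip h. *)
Definition spectral_basis h A (b : {ffun 'I_M * 'I_M -> 'M[R]_M * R}) : Prop :=
  (forall k l, ip h (b k).1 (b l).1 = (k == l)%:R) /\
  (forall k, A (b k).1 = (b k).2 *: (b k).1).

Definition eigenpairs h A : {ffun 'I_M * 'I_M -> 'M[R]_M * R} :=
  xget [ffun=> (0, 0)] (spectral_basis h A).

(* phi(A) v = \sum_k phi(lambda_k) <v, e_k> e_k; this is the matrix function
   phi(A) when A is self-adjoint (and does not depend on the chosen basis),
   and has no meaning otherwise. *)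
Definition opfun_fun h (phi : R -> R) A v : 'M[R]_M :=
  \sum_k (phi (eigenpairs h A k).2 * ip h v (eigenpairs h A k).1)
           *: (eigenpairs h A k).1.

Fact ip_linearl h a v v' w : ip h (a *: v + v') w = a * ip h v w + ip h v' w.
Proof.
rewrite /ip mulrCA -mulrDr; congr (_ * _); rewrite mulr_sumr -big_split /=.
apply: eq_bigr => i _; rewrite mulr_sumr -big_split /=.
by apply: eq_bigr => j _; rewrite !mxE mulrDl mulrA.
Qed.

Fact opfun_fun_is_linear h phi A : linear (opfun_fun h phi A).
Proof.
move=> a v w; rewrite /opfun_fun scaler_sumr -big_split /=.
by apply: eq_bigr => k _; rewrite ip_linearl scalerA -scalerDl; congr (_ *: _); ring.
Qed.

HB.instance Definition _ h phi A :=
  GRing.isLinear.Build R 'M[R]_M 'M[R]_M *:%R (opfun_fun h phi A)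
    (opfun_fun_is_linear h phi A).

Definition opfun h (phi : R -> R) A : 'End('M[R]_M) :=
  linfun (opfun_fun h phi A).

Lemma opfunE h phi A v : opfun h phi A v = opfun_fun h phi A v.
Proof. exact: lfunE. Qed.

End Grid.

(* Only meant for a != 0: the scheme applies it to negative definite
   operators. *)
Definition phi1 {R : realType} (a : R) : R := a^-1 * (expR a - 1).

Section Energies.
Context {R : realType} {M : nat}.
Variables (h eps : R) (F : R -> R).

Definition E1 (v : 'M[R]_M) : R := ip h (map_mx F v) (const_mx 1).

Definition Emod (v : 'M[R]_M) (r : R) : R :=
  eps ^+ 2 / 2 * norm2 h (grad h v) ^+ 2 + r.

End Energies.

Section Scheme.
Context {R : realType} {M : nat}.
Variables (h eps kappa : R) (f F sigma : R -> R) (tau : R).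
Implicit Types (u v : 'M[R]_M) (a r s : R).

Definition gsav v r : R := sigma r / sigma (E1 h F v).

(* In Lop and Nop, a is the frozen value of g: g(u^n, s^n) in the prediction,
   g at the predicted midpoint in the correction. *)
Definition Lop a : 'End('M[R]_M) := (kappa * a) *: \1%VF - eps ^+ 2 *: lap h.

Definition Nop a v r : 'M[R]_M :=
  gsav v r *: map_mx f v + (kappa * a) *: v.

Definition exp_step a u v r : 'M[R]_M :=
  opfun h expR (- tau *: Lop a) u
  + tau *: opfun h phi1 (- tau *: Lop a) (Nop a v r).

Definition predict (us : 'M[R]_M * R) : 'M[R]_M * R :=
  let: (u, s) := us in
  let a := gsav u s in
  let ut := exp_step a u u s in
  (ut, s - a * ip h (map_mx f u) (ut - u)).

Definition midpoint (us ust : 'M[R]_M * R) : 'M[R]_M * R :=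
  (2^-1 *: (us.1 + ust.1), 2^-1 * (us.2 + ust.2)).

Definition correct (us ust : 'M[R]_M * R) : 'M[R]_M * R :=
  let: (u, s) := us in
  let: (uh, sh) := midpoint us ust in
  let a := gsav uh sh in
  let u' := exp_step a u uh sh in
  (u', s - a * ip h (map_mx f uh) (u' - u)
         + kappa / 2 * a * ip h (u' - ust.1) (u' - u)).

Definition EI2_step (us : 'M[R]_M * R) : 'M[R]_M * R :=
  correct us (predict us).

Definition EI2 (uinit : 'M[R]_M) (n : nat) : 'M[R]_M * R :=
  iter n EI2_step (uinit, E1 h F uinit).

End Scheme.

(* Main.v *)
(* One correction step, started from any predicted pair (ut, st), dissipates the
   modified energy.  Let u' be the corrected value, w = u' - u, and let
   A = kappa a I - eps^2 lap, which is symmetric positive definite.  Since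
   (u + ut) / 2 + (u' - ut) / 2 = (u + u') / 2, the kappa-terms of the energy
   increment recombine with the gradient terms into
     <A u, w> + <A w, w> / 2 - <N, w>,
   where N is the nonlinear term of the exponential step.  In an orthonormal
   eigenbasis of A that step reads w = (1 - e^(-tau l)) (N / l - u) in the mode
   of eigenvalue l, so each mode contributes
     l w^2 (1 / 2 - 1 / (1 - e^(-tau l))) <= 0.
   The eigenbasis chosen by [eigenpairs] is meaningful because of the spectral
   theorem for real symmetric matrices, proved by Householder deflation. *)
Require Import Defs.
From HB Require Import structures.
From mathcomp Require Import all_boot all_order all_algebra ring lra.
From mathcomp Require Import all_classical all_reals all_analysis.
From mathcomp.real_closed Require Import complex.
Import Order.TTheory GRing.Theory Num.Theory.
Import numFieldNormedType.Exports.
Local Open Scope ring_scope.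

Set Implicit Arguments.
Unset Strict Implicit.
Unset Printing Implicit Defensive.

(** * Spectral theorem for real symmetric matrices *)

Lemma mulmx_tr_gt0 (R : realFieldType) n (v : 'rV[R]_n) :
  v != 0 -> 0 < (v *m v^T) 0 0.
Proof.
move=> /rV0Pn[i vi_neq0]; rewrite mxE (bigD1 i)//= mxE -expr2.
rewrite ltr_pwDl ?exprn_even_gt0 ?vi_neq0 ?orbT//.
by apply: sumr_ge0 => j _; rewrite mxE -expr2 sqr_ge0.
Qed.

(** An eigenpair exists over the complex extension. Symmetry makes its eigenvalue real, so the real
    and imaginary parts of the eigenvector satisfy the eigenvalue equation separately, and one of
    them is nonzero. *)
Lemma symmetric_eigenvector (R : rcfType) n (A : 'M[R]_n) :
  (0 < n)%N -> A^T = A ->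
  exists a : R, exists2 v : 'rV_n, v != 0 & v *m A = a *: v.
Proof.
move=> n_gt0 A_sym.
have [l /eigenvalueP[v vA v_neq0]] :=
  eigenvalue_closed (map_mx (real_complex R) A) n_gt0.
pose x := map_mx (@complex.Re R) v; pose y := map_mx (@complex.Im R) v.
have xA : x *m A = complex.Re l *: x - complex.Im l *: y.
  apply/rowP => j; have /rowP/(_ j)/(congr1 (@complex.Re R)) := vA.
  rewrite !mxE raddf_sum /=; case: l {vA} => a b.
  case: (v 0 j) => c d /= <-; apply: eq_bigr => i _; rewrite !mxE.
  by case: (v 0 i) => ? ? /=; ring.
have yA : y *m A = complex.Re l *: y + complex.Im l *: x.
  apply/rowP => j; have /rowP/(_ j)/(congr1 (@complex.Im R)) := vA.
  rewrite !mxE raddf_sum /=; case: l {vA xA} => a b.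
  case: (v 0 j) => c d /= <-; apply: eq_bigr => i _; rewrite !mxE.
  by case: (v 0 i) => ? ? /=; ring.
have xy : (x != 0) || (y != 0).
  rewrite -negb_and; apply: contra v_neq0 => /andP[/eqP/rowP x0 /eqP/rowP y0].
  apply/eqP/rowP => j; move: (x0 j) (y0 j); rewrite !mxE.
  by case: (v 0 j) => ? ? /= -> ->.
have norm_gt0 : 0 < (x *m x^T) 0 0 + (y *m y^T) 0 0.
  have ge0 (z : 'rV[R]_n) : 0 <= (z *m z^T) 0 0.
    by have [->|/mulmx_tr_gt0/ltW//] := eqVneq z 0; rewrite mul0mx mxE.
  by case/orP: xy => /mulmx_tr_gt0 ?; [apply: ltr_pwDl | apply: ltr_wpDl].
(* Expanding both sides of [x A y^T = y A x^T] leaves [Im l * (|x|^2 + |y|^2) = 0]. *)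
have Im_l : complex.Im l = 0.
  have : (x *m A *m y^T) 0 0 = (y *m A *m x^T) 0 0.
    rewrite -[in LHS](trmxK (x *m A *m y^T)) [LHS]mxE.
    by rewrite !trmx_mul trmxK A_sym mulmxA.
  have yx : (y *m x^T) 0 0 = (x *m y^T) 0 0.
    by rewrite -[in LHS](trmxK (y *m x^T)) [LHS]mxE trmx_mul trmxK.
  rewrite xA yA mulmxBl mulmxDl -!scalemxAl.
  rewrite [LHS]mxE [X in X + _ = _]mxE [X in _ + X = _]mxE.
  rewrite [X in _ + - X = _]mxE [RHS]mxE [X in _ = X + _]mxE.
  rewrite [X in _ = _ + X]mxE yx.
  move: norm_gt0; set p := (x *m x^T) 0 0; set q := (y *m y^T) 0 0 => pq_gt0 E.
  have /eqP : complex.Im l * (p + q) = 0 by lra.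
  by rewrite mulf_eq0 (gt_eqF pq_gt0) orbF => /eqP.
rewrite Im_l scale0r subr0 in xA; rewrite Im_l scale0r addr0 in yA.
by exists (complex.Re l); case/orP: xy => ?; [exists x | exists y].
Qed.

(** The Householder reflection in the hyperplane orthogonal to [v - w] swaps two vectors of equal
    length. *)
Lemma orthogonal_mx_transitive (R : realFieldType) n (v w : 'rV[R]_n) :
  v *m v^T = w *m w^T -> exists2 Q : 'M[R]_n, Q *m Q^T = 1%:M & w *m Q = v.
Proof.
move=> vv_ww; have [->|v_neq_w] := eqVneq v w.
  by exists 1%:M; rewrite ?trmx1 mulmx1.
pose u := v - w; pose c := (u *m u^T) 0 0.
have c_gt0 : 0 < c by apply: mulmx_tr_gt0; rewrite subr_eq0.
have c_neq0 : c != 0 by rewrite gt_eqF.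
have uu : u *m u^T = c%:M by apply: mx11_scalar.
(* Equal lengths give [|v - w|^2 = -2 <w, v - w>]. *)
have wu : w *m u^T = (- (c / 2))%:M.
  have wv_vw : v *m w^T = w *m v^T.
    by rewrite -[LHS]trmxK trmx_mul trmxK [LHS]mx11_scalar [RHS]mx11_scalar mxE.
  have : c%:M = - 2 *: (w *m u^T).
    rewrite -uu /u linearB /= mulmxBl !mulmxBr wv_vw vv_ww.
    by apply/matrixP => i j; rewrite !mxE; ring.
  move=> /(congr1 (fun M => (- 2^-1) *: M)); rewrite scalerA.
  have -> : - 2^-1 * - 2 = 1 :> R by field.
  rewrite scale1r => <-; rewrite scale_scalar_mx; congr (_%:M); by field.
exists (1%:M - (2 / c) *: (u^T *m u)).
  have -> : (1%:M - (2 / c) *: (u^T *m u))^T = 1%:M - (2 / c) *: (u^T *m u).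
    by rewrite [LHS]linearB /= trmx1 linearZ /= trmx_mul trmxK.
  rewrite mulmxBr mulmx1 mulmxBl mul1mx.
  rewrite -scalemxAl -scalemxAr mulmxA -(mulmxA _ u) uu mul_mx_scalar.
  rewrite -scalemxAl !scalerA.
  have -> : 2 / c * (2 / c * c) = 2 / c + 2 / c by field.
  by rewrite scalerDl opprB addrK subrK.
rewrite mulmxBr mulmx1 -scalemxAr mulmxA wu mul_scalar_mx scalerA.
have -> : 2 / c * - (c / 2) = -1 by field.
by rewrite scaleN1r opprK addrC subrK.
Qed.

(** Induction on the size: an orthogonal change of basis sends a unit eigenvector to the first basis
    vector, which splits off a block of size 1. *)
Theorem symmetric_diagonalizable (R : rcfType) n (A : 'M[R]_n) :
  A^T = A ->
  exists (P : 'M[R]_n) (d : 'rV_n), P *m P^T = 1%:M /\ P *m A = diag_mx d *m P.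
Proof.
elim: n A => [|n IHn]; first by exists 1%:M, 0; split; apply/matrixP => -[].
rewrite -[n.+1]/(1 + n)%N => A A_sym.
have [a [v0 v0_neq0 v0A]] :=
  symmetric_eigenvector (ltn0Sn n : 0 < 1 + n)%N A_sym.
pose e0 : 'rV[R]_(1 + n) := row_mx 1%:M 0.
pose c := (v0 *m v0^T) 0 0; pose v := (Num.sqrt c)^-1 *: v0.
have c_gt0 : 0 < c by apply: mulmx_tr_gt0.
have vA : v *m A = a *: v by rewrite -scalemxAl v0A !scalerA mulrC.
have vv : v *m v^T = e0 *m e0^T.
  rewrite tr_row_mx mul_row_col trmx1 trmx0 mulmx0 addr0 mulmx1.
  rewrite linearZ /= -scalemxAl -scalemxAr scalerA (mx11_scalar (v0 *m _)) -/c.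
  rewrite scale_scalar_mx -invfM -expr2 sqr_sqrtr ?(ltW c_gt0)//.
  by rewrite mulVf ?gt_eqF.
have [Q QQ e0Q] := orthogonal_mx_transitive (n := 1 + n) vv.
pose B : 'M[R]_(1 + n) := Q *m A *m Q^T.
have B_sym : B^T = B by rewrite !trmx_mul trmxK A_sym mulmxA.
have QA : Q *m A = B *m Q by rewrite /B -[RHS]mulmxA (mulmx1C QQ) mulmx1.
have e0B : e0 *m B = a *: e0.
  by rewrite /B !mulmxA e0Q vA -scalemxAl -e0Q -mulmxA QQ mulmx1.
(* The first row of [B] is [a *: e0]; symmetry then clears the rest of the first column. *)
have BE : B = block_mx a%:M 0 0 (drsubmx B).
  have uB : usubmx B = row_mx a%:M 0.
    rewrite -[a%:M]mulmx1 mul_scalar_mx -[X in row_mx _ X](scaler0 _ a).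
    rewrite -scale_row_mx -/e0 -e0B -[in RHS](vsubmxK B) mul_row_col.
    by rewrite mul1mx mul0mx addr0.
  rewrite -[LHS]submxK /ulsubmx /ursubmx uB row_mxKl row_mxKr.
  suff -> : dlsubmx B = 0 by [].
  by rewrite -B_sym -trmx_ursub /ursubmx uB row_mxKr trmx0.
have [|P [d [PP PB]]] := IHn (drsubmx B).
  by rewrite trmx_drsub B_sym.
exists (block_mx 1%:M 0 0 P *m Q), (row_mx (const_mx a) d); split.
  rewrite trmx_mul mulmxA -(mulmxA _ Q) QQ mulmx1 tr_block_mx !trmx0 trmx1.
  rewrite mulmx_block !mulmx0 !mul0mx !addr0 add0r PP mulmx1.
  by rewrite -scalar_mx_block.
rewrite -mulmxA QA BE !mulmxA diag_mx_row !mulmx_block.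
by rewrite !mulmx0 !mul0mx !addr0 !add0r PB mul1mx mulmx1 diag_const_mx.
Qed.

(** * Discrete inner product and summation by parts *)

Section InnerProduct.
Context {R : realType} {M : nat}.
Implicit Types (h a : R) (v w : 'M[R]_M).

Lemma ipC h v w : ip h v w = ip h w v.
Proof.
congr (_ * _); apply: eq_bigr => i _; apply: eq_bigr => j _.
exact: mulrC.
Qed.

Fact ip_is_linear h v : linear_for *%R (ip h v).
Proof. by move=> a w w'; rewrite ipC ip_linearl !(ipC h v). Qed.

HB.instance Definition _ h v :=
  GRing.isLinear.Build R 'M[R]_M R *%R (ip h v) (ip_is_linear h v).

Lemma ipDr h v w w' : ip h v (w + w') = ip h v w + ip h v w'.
Proof. exact: linearD. Qed.

Lemma ipBr h v w w' : ip h v (w - w') = ip h v w - ip h v w'.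
Proof. exact: linearB. Qed.

Lemma ipZr h a v w : ip h v (a *: w) = a * ip h v w.
Proof. exact: linearZ. Qed.

Lemma ipE h v w : ip h v w = h ^+ 2 * (mxvec v *m (mxvec w)^T) 0 0.
Proof.
rewrite mxE; congr (_ * _); rewrite pair_bigA /=.
rewrite [RHS](reindex _ (curry_mxvec_bij M M)) /=.
by apply: eq_bigr => -[i j] _ /=; rewrite mxE !mxvecE.
Qed.

Lemma ip_ge0 h v : 0 <= ip h v v.
Proof.
apply: mulr_ge0; first exact: sqr_ge0.
by do 2!apply: sumr_ge0 => ? _; rewrite -expr2 sqr_ge0.
Qed.

(** Summation by parts on a cycle: there are no boundary terms, because a sum over the period is
    invariant under the shift [ordS]. *)
Lemma sum_second_difference (x y : 'I_M -> R) :
  \sum_i (x (ordS i) + x (ord_pred i) - 2 * x i) * y i =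
  - \sum_i (x (ordS i) - x i) * (y (ordS i) - y i).
Proof.
have shift (z : 'I_M -> R) : \sum_i z (ordS i) = \sum_i z i.
  by rewrite [RHS](reindex (@ordS M)) //; apply/onW_bij/ordS_bij.
have -> : \sum_i (x (ordS i) + x (ord_pred i) - 2 * x i) * y i =
    \sum_i x (ordS i) * y i + \sum_i x (ord_pred i) * y i
    - \sum_i x i * y i - \sum_i x i * y i.
  by rewrite -big_split -!sumrB; apply: eq_bigr => i _ /=; ring.
rewrite -(shift (fun i => x (ord_pred i) * y i)).
rewrite -[X in _ - X - _](shift (fun i => x i * y i)).
rewrite -big_split -!sumrB -sumrN; apply: eq_bigr => i _ /=.
by rewrite ordSK; ring.
Qed.

(** Discrete Green formula, from summation by parts along each of the two grid directions. *)
Lemma ip_lap h v w : ip h (lap h v) w = - ip2 h (grad h v) (grad h w).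
Proof.
rewrite lapE /ip2 /ip -mulrDr -mulrN; congr (_ * _).
transitivity (h ^- 2 * (
    \sum_j \sum_i (v (ordS i) j + v (ord_pred i) j - 2 * v i j) * w i j
  + \sum_i \sum_j (v i (ordS j) + v i (ord_pred j) - 2 * v i j) * w i j)).
  rewrite [X in _ = _ * (X + _)]exchange_big -big_split mulr_sumr.
  apply: eq_bigr => i _ /=.
  by rewrite -big_split mulr_sumr; apply: eq_bigr => j _; rewrite !mxE /=; ring.
under eq_bigr do rewrite (sum_second_difference (v ^~ _) (w ^~ _)).
under [X in _ + X]eq_bigr do rewrite (sum_second_difference (v _) (w _)).
rewrite !sumrN -opprD mulrN exchange_big mulrDr !mulr_sumr; congr (- (_ + _)).
  apply: eq_bigr => i _; rewrite mulr_sumr; apply: eq_bigr => j _.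
  by rewrite !mxE -exprVn expr2; ring.
apply: eq_bigr => i _; rewrite mulr_sumr; apply: eq_bigr => j _.
by rewrite !mxE -exprVn expr2; ring.
Qed.

Lemma norm2_grad h v : norm2 h (grad h v) ^+ 2 = - ip h (lap h v) v.
Proof. by rewrite ip_lap opprK sqr_sqrtr // addr_ge0 ?ip_ge0. Qed.

Lemma lap_selfadjoint h v w : ip h (lap h v) w = ip h v (lap h w).
Proof. by rewrite [RHS]ipC !ip_lap /ip2 ipC (ipC _ (grad h v).2). Qed.

End InnerProduct.

(** * Orthonormal eigenbases and functions of self-adjoint grid operators *)

Section Spectral.
Context {R : realType} {M : nat}.
Implicit Types (h : R) (A : 'End('M[R]_M)) (v w : 'M[R]_M).

Lemma spectral_basis_exists h A : h != 0 ->
  (forall v w, ip h (A v) w = ip h v (A w)) -> exists b, spectral_basis h A b.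
Proof.
move=> h_neq0 A_sym; pose N := lin_mx A.
have N_entry i j : N i j =
    (mxvec (A (vec_mx (delta_mx 0 i)))
      *m (mxvec (vec_mx (delta_mx 0 j)))^T) 0 0.
  rewrite -mul_vec_lin !vec_mxK -/N trmx_delta -rowE -colE.
  by rewrite !mxE.
have N_sym : N^T = N.
  apply/matrixP => i j; rewrite mxE !N_entry.
  apply: (mulfI (expf_neq0 2 h_neq0)).
  by rewrite -!ipE A_sym ipC.
have [P [d [PP PN]]] := symmetric_diagonalizable N_sym.
(* The factor [h^-1] turns unit length for the dot product into unit length for [ip h], which
   carries the weight [h ^+ 2]. *)
exists [ffun k => (h^-1 *: vec_mx (row (mxvec_index k.1 k.2) P),
                   d 0 (mxvec_index k.1 k.2))].
split=> [k l|k]; rewrite !ffunE /=.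
  rewrite ipZr ipC ipZr ipC ipE !vec_mxK.
  have -> : (row (mxvec_index k.1 k.2) P *m (row (mxvec_index l.1 l.2) P)^T) 0 0
      = (P *m P^T) (mxvec_index k.1 k.2) (mxvec_index l.1 l.2).
    by rewrite !mxE; apply: eq_bigr => i _; rewrite !mxE.
  rewrite PP mxE mulrA mulrA -expr2 exprVn mulVf ?expf_neq0 // mul1r.
  congr ((nat_of_bool _)%:R); case: k l => [i1 j1] [i2 j2] /=.
  apply/idP/idP => [|/eqP[-> ->]//].
  have [g gK _] := curry_mxvec_bij M M.
  by move=> /eqP/(congr1 g) E; rewrite -(gK (i1, j1))// -(gK (i2, j2))// /= E.
rewrite linearZ scalerA mulrC -scalerA; congr (_ *: _).
by rewrite -mx_rV_lin -row_mul PN row_mul row_diag_mx -scalemxAl -rowE linearZ.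
Qed.

Lemma eigenpairsP h A : h != 0 ->
  (forall v w, ip h (A v) w = ip h v (A w)) ->
  spectral_basis h A (eigenpairs h A).
Proof.
by move=> h_neq0 A_sym; apply: xgetPex; apply: spectral_basis_exists.
Qed.

(** Completeness comes from counting: [M ^ 2] orthonormal vectors are the rows of a square matrix
    [Q], so [Q *m Q^T = 1] also yields [Q^T *m Q = 1]. *)
Lemma parseval h A b v w : spectral_basis h A b ->
  ip h v w = \sum_k ip h v (b k).1 * ip h w (b k).1.
Proof.
move=> [b_orth _].
have [g gK Kg] := curry_mxvec_bij M M.
pose Q := \matrix_i (h *: mxvec (b (g i)).1).
have mulQ x i : (mxvec x *m Q^T) 0 i * h = ip h x (b (g i)).1.
  rewrite ipE expr2 mxE -mulrA mulrC; congr (_ * _); rewrite mxE mulr_sumr.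
  by apply: eq_bigr => j _; rewrite !mxE; ring.
have QQ : Q *m Q^T = 1%:M.
  apply/matrixP => i j; rewrite [RHS]mxE.
  transitivity (ip h (b (g i)).1 (b (g j)).1).
    rewrite ipE !mxE mulr_sumr; apply: eq_bigr => k _; rewrite !mxE; ring.
  rewrite b_orth; congr ((nat_of_bool _)%:R); apply: can_eq => x.
  exact: Kg.
rewrite ipE -[mxvec v]mulmx1 -(mulmx1C QQ) !mulmxA -mulmxA.
have -> : Q *m (mxvec w)^T = (mxvec w *m Q^T)^T by rewrite trmx_mul trmxK.
rewrite mxE mulr_sumr.
rewrite [RHS](reindex g); last first.
  by exists (uncurry (@mxvec_index M M)) => *; rewrite ?gK ?Kg.
by apply: eq_bigr => i _; rewrite -!mulQ [_^T i 0]mxE; ring.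
Qed.

Lemma ip_opfun h A phi v k : spectral_basis h A (eigenpairs h A) ->
  ip h (opfun h phi A v) (eigenpairs h A k).1 =
  phi (eigenpairs h A k).2 * ip h v (eigenpairs h A k).1.
Proof.
move=> [e_orth _]; rewrite opfunE ipC linear_sum (bigD1 k) //= big1 => [|l lk].
  by rewrite ipZr e_orth eqxx mulr1 addr0.
by rewrite ipZr e_orth eq_sym (negPf lk) mulr0.
Qed.

End Spectral.

(** With [e = expR (- tau * l)] in (0, 1) and the residual [r = N - l * u], the increment is
    [w = (1 - e) / l * r], and the left side equals [- (1 - e) (1 + e) / (2 l) * r ^+ 2]. *)
Lemma phi1_mode_dissipation (R : realType) (l tau u N w : R) :
  0 < l -> 0 < tau ->
  w = expR (- tau * l) * u + tau * (phi1 (- tau * l) * N) - u ->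
  l * u * w + 2^-1 * (l * w * w) - N * w <= 0.
Proof.
move=> l_gt0 tau_gt0 ->; rewrite /phi1; set e := expR _.
have e_gt0 : 0 < e by apply: expR_gt0.
have e_lt1 : e < 1 by rewrite expR_lt1 mulNr oppr_lt0 mulr_gt0.
have l_neq0 : l != 0 by rewrite gt_eqF.
have tau_neq0 : tau != 0 by rewrite gt_eqF.
have -> : e * u + tau * ((- tau * l)^-1 * (e - 1) * N) - u =
    (1 - e) / l * (N - l * u).
  by field; rewrite l_neq0 tau_neq0.
set r := N - l * u.
have -> : l * u * ((1 - e) / l * r) +
    2^-1 * (l * ((1 - e) / l * r) * ((1 - e) / l * r)) - N * ((1 - e) / l * r) =
  - ((1 - e) * (1 + e) / (2 * l) * r ^+ 2).
  by rewrite /r; field.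
rewrite oppr_le0 mulr_ge0 ?sqr_ge0 // divr_ge0 ?mulr_ge0 //; lra.
Qed.

(** * Energy dissipation of the scheme *)

Section Step.
Context {R : realType} {M : nat}.
Variables (h eps kappa : R) (f F sigma : R -> R) (tau : R).
Hypotheses (h_neq0 : h != 0) (kappa_gt0 : 0 < kappa) (tau_gt0 : 0 < tau).
Implicit Types (u v w : 'M[R]_M) (a s r : R).

Lemma LopE a v : Lop h eps kappa a v = (kappa * a) *: v - eps ^+ 2 *: lap h v.
Proof. by rewrite add_lfunE opp_lfunE !scale_lfunE id_lfunE. Qed.

Lemma Lop_selfadjoint a v w :
  ip h (Lop h eps kappa a v) w = ip h v (Lop h eps kappa a w).
Proof.
by rewrite !LopE ipC !ipBr !ipZr (ipC h w v) (ipC h w) lap_selfadjoint.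
Qed.

(** Minus the Laplacian is nonnegative by summation by parts. The bound makes the eigenvalues
    positive when [a] is. *)
Lemma Lop_coercive a v : kappa * a * ip h v v <= ip h (Lop h eps kappa a v) v.
Proof.
rewrite LopE ipC ipBr !ipZr (ipC h v (lap h v)) -mulrN -norm2_grad.
by rewrite lerDl mulr_ge0 ?sqr_ge0.
Qed.

Lemma exp_step_dissipation a u v s w : 0 < a ->
  w = exp_step h eps kappa f F sigma tau a u v s - u ->
  ip h (Lop h eps kappa a u) w + 2^-1 * ip h (Lop h eps kappa a w) w
  <= ip h (Nop h kappa f F sigma a v s) w.
Proof.
move=> a_gt0 wE; rewrite -subr_le0; set A := Lop _ _ _ _.
set N := Nop _ _ _ _ _ _ _ _.
(* The scheme takes functions of [- tau *: A], so the chosen eigenbasis is that of [T]; the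
   eigenvalues [l k] of [A] are recovered by dividing by [- tau]. *)
pose T : 'End('M[R]_M) := - tau *: A.
have AE x : A x = (- tau^-1) *: T x.
  by rewrite scale_lfunE scalerA mulNr mulrN opprK mulVf ?gt_eqF ?scale1r.
have T_sym x y : ip h (T x) y = ip h x (T y).
  by rewrite !scale_lfunE ipC !ipZr ipC Lop_selfadjoint.
have T_basis := eigenpairsP h_neq0 T_sym.
have [e_orth e_eigen] := T_basis.
set e := eigenpairs h T in T_basis e_orth e_eigen.
pose l k := - tau^-1 * (e k).2.
have Ae k : A (e k).1 = l k *: (e k).1 by rewrite AE e_eigen scalerA.
have eE k : (e k).2 = - tau * l k.
  by rewrite /l mulrA mulNr mulrN opprK mulfV ?mul1r ?gt_eqF.
have l_gt0 k : 0 < l k.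
  have := Lop_coercive a (e k).1; rewrite -/A Ae [leRHS]ipC ipZr.
  by rewrite e_orth eqxx !mulr1; apply: lt_le_trans; rewrite mulr_gt0.
have ipA x k : ip h (A x) (e k).1 = l k * ip h x (e k).1.
  by rewrite Lop_selfadjoint Ae ipZr.
have ipw k : ip h w (e k).1 = expR (- tau * l k) * ip h u (e k).1
    + tau * (phi1 (- tau * l k) * ip h N (e k).1) - ip h u (e k).1.
  rewrite wE /exp_step ipC ipBr ipDr ipZr !(ipC h (e k).1).
  by rewrite !ip_opfun // -/T -/e eE.
(* Parseval splits the inequality into one scalar inequality per mode. *)
rewrite !(parseval _ _ T_basis) mulr_sumr -big_split -sumrB /=.
apply: sumr_le0 => k _; rewrite !ipA.
exact: phi1_mode_dissipation (l_gt0 k) tau_gt0 (ipw k).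
Qed.

Lemma Emod_correct_le (sigma_gt0 : forall x, 0 < sigma x)
    (us ust : 'M[R]_M * R) :
  let us' := correct h eps kappa f F sigma tau us ust in
  Emod h eps us'.1 us'.2 <= Emod h eps us.1 us.2.
Proof.
case: us ust => u s [ut st]; rewrite /correct /=.
set uh := 2^-1 *: _; set sh := 2^-1 * _.
set a := gsav _ _ _ _ _; set u' := exp_step _ _ _ _ _ _ _ _ _ _ _.
have a_gt0 : 0 < a by apply: divr_gt0.
have := exp_step_dissipation a_gt0 (erefl (u' - u)).
(* In terms of the increment [w], the energy difference is a linear combination of inner products
   that equals the difference of the two sides of the dissipation inequality. *)
have : u' = u + (u' - u) by rewrite addrC subrK.
move: (u' - u) => w ->; rewrite !LopE /Emod !norm2_grad /Nop -/a.
set fu := map_mx f uh; rewrite /uh (linearD (lap h)) /=.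
rewrite !(ipC h _ w) !ipBr !ipDr !ipZr !ipDr.
rewrite !(ipC h (_ + _)) !ipDr (ipC h u (lap h w)) lap_selfadjoint.
rewrite (ipC h (lap h u) u); lra.
Qed.
End Step.

Theorem theorem3p8 (R : realType) (L : R) (M : nat) (eps beta kappa tau : R)
    (f F sigma : R -> R) (uinit : 'M[R]_M) (n : nat)
    (L_gt0 : 0 < L) (M_gt0 : (0 < M)%N) (eps_gt0 : 0 < eps)
    (f_C1 : C1 f) (beta_gt0 : 0 < beta)
    (f_beta : f beta <= 0) (f_Nbeta : 0 <= f (- beta))
    (F_prim : forall x : R, is_derive x 1 F (- f x))
    (kappa_gt0 : 0 < kappa)
    (sigma_C1 : C1 sigma) (sigma_gt0 : forall x : R, 0 < sigma x)
    (dsigma_ge0 : forall x : R, 0 <= derive1 sigma x)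
    (tau_gt0 : 0 < tau) :
  let h := L / M%:R in
  let us := EI2 h eps kappa f F sigma tau uinit in
  Emod h eps (us n.+1).1 (us n.+1).2 <= Emod h eps (us n).1 (us n).2.
Proof.
(* Iterate [n.+1] is [correct] applied to iterate [n] and its prediction, and the bound holds for
   any predicted pair. *)
by apply: Emod_correct_le; rewrite // gt_eqF // divr_gt0 ?ltr0n.
Qed.
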